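(* Let $a:\mathbb{Z}_{\geq 1}\to\mathbb{Z}$ be a good integer-valued sequence (in the sense defined in the context). Then $a(n)$ is Benford.
   Context: Notation: $f(x)\sim g(x)$ means $\lim_{x\to\infty} f(x)/g(x)=1$. An integer-valued sequence $a(n)$ is called \emph{good} if $a(n)\sim b(n)e^{c(n)}$, where $b$ and $c$ are real-valued functions of a real variable $x$ (defined for all sufficiently large $x$, with $b(x)>0$) such that: (1) there is an integer $h\geq 1$ such that $c$ is $h$-times differentiable and $c^{(h)}(x)$ tends to $0$ monotonically for sufficiently large $x$; (2) $\lim_{x\to\infty} x\,|c^{(h)}(x)|=\infty$; (3) $\lim_{x\to\infty} \frac{D^{(h)}\log b(x)}{c^{(h)}(x)}=0$, where $D^{(h)}$ denotes the $h$-th derivative. Benford sequences: fix an integer base $k\geq 2$ and a positive integer $d$ (viewed as a string of base-$k$ digits with nonzero leading digit). A positive integer $m$ has \emph{first digits $d$ in base $k$} if its base-$k$ expansion begins with the digit string of $d$, i.e. $d\,k^j\leq m<(d+1)k^j$ for some integer $j\geq 0$. For a sequence $a(n)$ set $B(d,x,k;a(n))=\frac{1}{x}\#\{1\le n\le x : a(n)>0 \text{ and the first digits of } a(n) \text{ in base } k \text{ are } d\}$. The sequence $a(n)$ is \emph{Benford} if for every integer $k\geq 2$ and every such string $d$, the limit $\lim_{x\to\infty}B(d,x,k;a(n))$ exists and is congruent modulo $1$ to $\log_k(d+1)-\log_k(d)$. *)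

(* Defs.v *)
From Stdlib Require Export Reals ZArith List Lia Lra.
From Coquelicot Require Export Coquelicot.

Open Scope R_scope.

Definition eventually_monotone (f : R -> R) : Prop :=
  exists X : R,
    (forall x y : R, X <= x -> x <= y -> f x <= f y) \/
    (forall x y : R, X <= x -> x <= y -> f y <= f x).

(* Coquelicot's [ex_derive_n f h x] only speaks about the last derivation step
   (lower derivatives may be default values), hence the quantifier over all
   orders [m <= h]. *)
Definition eventually_diff (h : nat) (f : R -> R) : Prop :=
  Rbar_locally p_infty
    (fun x => forall m : nat, (m <= h)%nat -> ex_derive_n f m x).

(* Sequences indexed by the integers [n >= 1] are functions on [nat] whose value
   at [0] is never used.  Similarly [b] and [c] are total functions, but every
   condition only involves their values for large arguments. *)
Definition good (a : nat -> Z) : Prop :=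
  exists b c : R -> R,
    Rbar_locally p_infty (fun x => 0 < b x) /\
    is_lim_seq (fun n => IZR (a n) / (b (INR n) * exp (c (INR n)))) 1 /\
    exists h : nat,
      (1 <= h)%nat /\
      eventually_diff h c /\
      eventually_monotone (Derive_n c h) /\
      is_lim (Derive_n c h) p_infty 0 /\
      is_lim (fun x => x * Rabs (Derive_n c h x)) p_infty p_infty /\
      eventually_diff h (fun x => ln (b x)) /\
      is_lim (fun x => Derive_n (fun t => ln (b t)) h x / Derive_n c h x)
        p_infty 0.

Definition first_digits (k d m : Z) : Prop :=
  exists j : nat,
    (d * k ^ Z.of_nat j <= m < (d + 1) * k ^ Z.of_nat j)%Z.

(* For [k >= 2] and [d >= 1], [first_digits k d m] forces [j < m], so a bounded
   search for [j] decides it. *)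
Definition first_digitsb (k d m : Z) : bool :=
  existsb
    (fun j => ((d * k ^ Z.of_nat j <=? m)%Z && (m <? (d + 1) * k ^ Z.of_nat j)%Z)%bool)
    (seq 0 (Z.to_nat m)).

Lemma first_digitsP (k d m : Z) :
  (2 <= k)%Z -> (1 <= d)%Z -> first_digitsb k d m = true <-> first_digits k d m.
Proof.
intros hk hd; unfold first_digitsb, first_digits; rewrite existsb_exists; split.
- intros [j [_ hj]]; exists j.
  apply andb_prop in hj; destruct hj as [h1 h2].
  apply Z.leb_le in h1; apply Z.ltb_lt in h2; lia.
- intros [j [h1 h2]]; exists j; split.
  + apply in_seq.
    assert (hp : (Z.of_nat j < k ^ Z.of_nat j)%Z)
      by (apply Z.pow_gt_lin_r; lia).
    assert (k ^ Z.of_nat j <= d * k ^ Z.of_nat j)%Z by nia.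
    lia.
  + apply andb_true_intro; split; [apply Z.leb_le | apply Z.ltb_lt]; lia.
Qed.

(* [Int_part] is the floor function. *)
Definition B (d : Z) (x : R) (k : Z) (a : nat -> Z) : R :=
  / x * INR (length (filter
    (fun n => ((0 <? a n)%Z && first_digitsb k d (a n))%bool)
    (seq 1 (Z.to_nat (Int_part x))))).

Definition log_base (k x : R) : R := ln x / ln k.

Definition congruent_mod1 (x y : R) : Prop := exists z : Z, x - y = IZR z.

Definition benford (a : nat -> Z) : Prop :=
  forall k d : Z, (2 <= k)%Z -> (1 <= d)%Z ->
  exists L : R,
    is_lim (fun x => B d x k a) p_infty L /\
    congruent_mod1 L
      (log_base (IZR k) (IZR (d + 1)) - log_base (IZR k) (IZR d)).

(* Main.v *)
Require Import Defs.

(* Put [F n = c n + ln (b n)], so that [ln (a n) - F n] tends to 0.  By the mean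
   value theorem the [h]-th forward difference of [F] is asymptotic to a monotone
   null sequence [g] with [n * g n -> oo] (up to sign).  For [h = 1], summation by
   parts as in Fejer's theorem shows that the averages of [cos (F n)] tend to 0;
   van der Corput's inequality reduces [h + 1] to [h], since [F (n + q) - F n] has
   [h]-th differences of the same kind.  The class of such [F] is stable under
   nonzero scaling and, as [h >= 1], under adding constants, so Weyl's criterion,
   here in the form of a majorant built from Fejer kernels, makes
   [ln (a n) / ln k] equidistributed modulo 1.  Finally [a n] tends to infinity,
   and for large [m] the first digits of [m] are [d] iff [ln m / ln k] lies modulo
   1 in the arc from [log_k d] to [log_k (d + 1)]. *)

(** * Averages and van der Corput's inequality *)

Definition Mean (u : nat -> R) (l : R) : Prop :=
  is_lim_seq (fun N => sum_f_R0 u N / INR (S N)) l.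

Lemma INR_S_pos N : 0 < INR (S N).
Proof. apply lt_0_INR; lia. Qed.

Lemma Mean_ext u v l : (forall n, u n = v n) -> Mean u l -> Mean v l.
Proof.
intros H; apply is_lim_seq_ext; intros N; f_equal; apply sum_eq; intros; apply H.
Qed.

Lemma Mean_const x : Mean (fun _ => x) x.
Proof.
apply is_lim_seq_ext with (fun _ => x); [|apply is_lim_seq_const].
intros N; rewrite sum_cte; field; apply Rgt_not_eq, INR_S_pos.
Qed.

Lemma Mean_plus u v l m :
  Mean u l -> Mean v m -> Mean (fun n => u n + v n) (l + m).
Proof.
intros Hu Hv; eapply is_lim_seq_ext; [|exact (is_lim_seq_plus' _ _ _ _ Hu Hv)].
intros N; simpl; rewrite sum_plus; unfold Rdiv; ring.
Qed.

Lemma Mean_scal x u l : Mean u l -> Mean (fun n => x * u n) (x * l).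
Proof.
intros Hu; eapply is_lim_seq_ext; [|exact (is_lim_seq_scal_l _ x _ Hu)].
intros N; simpl.
replace (sum_f_R0 (fun n => x * u n) N) with (x * sum_f_R0 u N).
- unfold Rdiv; ring.
- rewrite scal_sum; apply sum_eq; intros; ring.
Qed.

Lemma Mean_sum (u : nat -> nat -> R) (l : nat -> R) M :
  (forall i, (i <= M)%nat -> Mean (u i) (l i)) ->
  Mean (fun n => sum_f_R0 (fun i => u i n) M) (sum_f_R0 l M).
Proof.
induction M as [|M IH]; simpl; intros H.
- apply (H 0%nat); lia.
- apply Mean_plus; [apply IH; intros; apply H; lia | apply H; lia].
Qed.

Lemma Mean_lim u (l : R) : is_lim_seq u l -> Mean u l.
Proof.
intros Hu; apply is_lim_seq_Reals in Hu; apply Cesaro_1 in Hu.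
apply is_lim_seq_Reals in Hu; apply is_lim_seq_incr_1 in Hu.
exact Hu.
Qed.

(** Dropping one initial term changes the average by [O(1/N)]. This is how the finitely many indices
    where [a n] may still be small get discarded. *)
Lemma Mean_of_shift N0 u l : Mean (fun n => u (n + N0)%nat) l -> Mean u l.
Proof.
revert u; induction N0 as [|N0 IH]; intros u H.
- revert H; apply Mean_ext; intros n; f_equal; lia.
- assert (H1 : Mean (fun n => u (S n)) l).
  { apply (IH (fun n => u (S n))); revert H; apply Mean_ext; intros n; f_equal; lia. }
  clear H IH; apply is_lim_seq_incr_1.
  assert (Hi : is_lim_seq (fun N => / INR (S (S N))) 0).
  { apply (is_lim_seq_inv _ p_infty); [|discriminate].
    apply (is_lim_seq_incr_1 (fun n => INR (S n))), (is_lim_seq_incr_1 INR).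
    apply is_lim_seq_INR. }
  (* The average of the first [N + 2] terms is [u 0 / (N + 2)] plus the shifted average times
     [1 - 1 / (N + 2)]. *)
  replace l with (u 0%nat * 0 + l * (1 - 0)) by ring.
  eapply is_lim_seq_ext; [|apply is_lim_seq_plus';
    [exact (is_lim_seq_scal_l _ (u 0%nat) _ Hi)
    |apply is_lim_seq_mult'; [exact H1|
       exact (is_lim_seq_minus' _ _ _ _ (is_lim_seq_const 1) Hi)]]].
  intros N; simpl Rbar_mult. rewrite (decomp_sum u (S N)) by lia.
  simpl pred. rewrite (S_INR (S N)). pose proof (INR_S_pos N). field; lra.
Qed.

(** The bounding sequences may change with [eps]; only their means have to approach [l]. *)
Lemma Mean_sandwich u l :
  (forall eps, 0 < eps -> exists v m, Mean v m /\ m < l + eps /\ forall n, u n <= v n) ->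
  (forall eps, 0 < eps -> exists v m, Mean v m /\ l - eps < m /\ forall n, v n <= u n) ->
  Mean u l.
Proof.
intros Hup Hlo; apply is_lim_seq_spec; intros eps; pose proof (cond_pos eps) as He.
destruct (Hup _ He) as (v & m & Hv & Hm & Huv).
destruct (Hlo _ He) as (v' & m' & Hv' & Hm' & Huv').
assert (E1 : 0 < l + eps - m) by lra. assert (E2 : 0 < m' - (l - eps)) by lra.
apply is_lim_seq_spec in Hv; apply is_lim_seq_spec in Hv'.
generalize (filter_and _ _ (Hv (mkposreal _ E1)) (Hv' (mkposreal _ E2))).
apply filter_imp; intros N; simpl pos; intros [A1 A2].
apply Rabs_def2 in A1; apply Rabs_def2 in A2.
assert (Hi := Rinv_0_lt_compat _ (INR_S_pos N)).
assert (sum_f_R0 u N / INR (S N) <= sum_f_R0 v N / INR (S N))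
  by (apply Rmult_le_compat_r; [lra|apply sum_Rle; auto]).
assert (sum_f_R0 v' N / INR (S N) <= sum_f_R0 u N / INR (S N))
  by (apply Rmult_le_compat_r; [lra|apply sum_Rle; auto]).
apply Rabs_def1; lra.
Qed.

Lemma Mean_zero_of_abs_le u :
  (forall eps, 0 < eps -> exists w v m,
     Mean w 0 /\ Mean v m /\ m < eps /\ forall n, Rabs (u n - w n) <= v n) ->
  Mean u 0.
Proof.
intros H; apply Mean_sandwich; intros eps He;
  destruct (H _ He) as (w & v & m & Hw & Hv & Hm & Hu).
- exists (fun n => w n + v n), (0 + m); split; [now apply Mean_plus|split; [lra|]].
  intros n; specialize (Hu n); apply Rabs_le_between in Hu; lra.
- exists (fun n => w n + (-1) * v n), (0 + (-1) * m).
  split; [now apply Mean_plus, Mean_scal|split; [lra|]].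
  intros n; specialize (Hu n); apply Rabs_le_between in Hu; lra.
Qed.

Lemma sum_swap (u : nat -> nat -> R) N M :
  sum_f_R0 (fun i => sum_f_R0 (fun j => u i j) M) N =
  sum_f_R0 (fun j => sum_f_R0 (fun i => u i j) N) M.
Proof.
induction N as [|N IH]; simpl; [reflexivity|].
now rewrite IH, <- sum_plus.
Qed.

Lemma sum_delta (x : R) i M :
  sum_f_R0 (fun j => if Nat.eqb i j then x else 0) M = if Nat.leb i M then x else 0.
Proof.
induction M as [|M IH]; [destruct i; reflexivity|].
rewrite tech5, IH.
destruct (Nat.leb_spec i M), (Nat.eqb_spec i (S M)), (Nat.leb_spec i (S M)); lia || lra.
Qed.

Lemma sum_diag (x : R) M :
  sum_f_R0 (fun i => sum_f_R0 (fun j => if Nat.eqb i j then x else 0) M) M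
  = x * INR (S M).
Proof.
rewrite <- sum_cte; apply sum_eq; intros i Hi; rewrite sum_delta.
destruct (Nat.leb_spec i M); [reflexivity|lia].
Qed.

(** The squared modulus of the sum of the [exp (i x_j)], expanded in real form. *)
Lemma cos_sin_sum_sq (x : nat -> R) M :
  (sum_f_R0 (fun i => cos (x i)) M)² + (sum_f_R0 (fun i => sin (x i)) M)²
  = sum_f_R0 (fun i => sum_f_R0 (fun j => cos (x i - x j)) M) M.
Proof.
unfold Rsqr; rewrite !scal_sum, <- sum_plus; apply sum_eq; intros i _.
rewrite !scal_sum, <- sum_plus; apply sum_eq; intros j _; rewrite cos_minus; ring.
Qed.

(** Only the [M + 1] diagonal terms, each equal to 1, survive averaging. This serves both van der
    Corput's inequality and the Fejer kernels. *)
Lemma Mean_cos_sin_sum_sq (x : nat -> nat -> R) M :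
  (forall i j, (i <= M)%nat -> (j <= M)%nat -> i <> j ->
     Mean (fun n => cos (x n i - x n j)) 0) ->
  Mean (fun n => (sum_f_R0 (fun i => cos (x n i)) M)²
                 + (sum_f_R0 (fun i => sin (x n i)) M)²) (INR (S M)).
Proof.
intros H; rewrite <- (Rmult_1_l (INR (S M))), <- sum_diag.
apply Mean_ext with (fun n => sum_f_R0 (fun i =>
  sum_f_R0 (fun j => cos (x n i - x n j)) M) M).
{ intros n; symmetry; apply cos_sin_sum_sq. }
apply (Mean_sum (fun i n => sum_f_R0 (fun j => cos (x n i - x n j)) M)); intros i Hi.
apply (Mean_sum (fun j n => cos (x n i - x n j))); intros j Hj.
destruct (Nat.eqb_spec i j) as [->|Hij]; [|now apply H].
apply Mean_ext with (fun _ => 1); [|apply Mean_const].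
intros n; now rewrite Rminus_diag, cos_0.
Qed.

Lemma Mean_bounded_diff (v : nat -> R) :
  (forall n, Rabs (v n) <= 1) -> Mean (fun n => v (S n) - v n) 0.
Proof.
intros Hv.
assert (Hi : is_lim_seq (fun N => 2 * / INR (S N)) 0).
{ replace (Finite 0) with (Rbar_mult 2 0) by (simpl; f_equal; ring).
  apply is_lim_seq_scal_l, (is_lim_seq_inv _ p_infty); [|discriminate].
  apply (is_lim_seq_incr_1 INR), is_lim_seq_INR. }
apply is_lim_seq_abs_0.
apply is_lim_seq_le_le with (fun _ => 0) (fun N => 2 * / INR (S N));
  [|apply is_lim_seq_const|exact Hi].
intros N; split; [apply Rabs_pos|].
assert (E : sum_f_R0 (fun n => v (S n) - v n) N = v (S N) - v 0%nat)
  by (induction N as [|N IH]; simpl; [|rewrite IH; simpl]; lra).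
pose proof (Rinv_0_lt_compat _ (INR_S_pos N)).
rewrite E; unfold Rdiv; rewrite Rabs_mult, (Rabs_pos_eq (/ _)) by lra.
apply Rmult_le_compat_r; [lra|].
apply Rabs_le; generalize (Hv 0%nat) (Hv (S N)); intros H1%Rabs_le_between H2%Rabs_le_between; lra.
Qed.

Lemma Mean_bounded_shift_diff (v : nat -> R) j :
  (forall n, Rabs (v n) <= 1) -> Mean (fun n => v (n + j)%nat - v n) 0.
Proof.
intros Hv; induction j as [|j IH].
- apply Mean_ext with (fun _ => 0); [|apply Mean_const].
  intros n; rewrite Nat.add_0_r; lra.
- rewrite <- (Rplus_0_l 0).
  eapply Mean_ext; [|apply (Mean_plus _ _ _ _ IH
     (Mean_bounded_diff (fun n => v (n + j)%nat) (fun n => Hv _)))].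
  intros n; simpl; rewrite Nat.add_succ_r; lra.
Qed.

Lemma Rabs_cos_le_1 x : Rabs (cos x) <= 1.
Proof. apply Rabs_le, COS_bound. Qed.

Lemma Rabs_sin_le_1 x : Rabs (sin x) <= 1.
Proof. apply Rabs_le, SIN_bound. Qed.

Lemma exists_INR_S_gt (x : R) : exists M, x < INR (S M).
Proof.
destruct (nfloor_ex (Rmax 0 x)) as [n [_ Hn]]; [apply Rmax_l|].
exists n; rewrite S_INR; pose proof (Rmax_r 0 x); lra.
Qed.

(** Up to a sequence of mean zero, [cos (f n)] may be replaced by its average over a window of
    [M + 1] shifts. The mean square of that average is at most [1 / (M + 1)], and a weighted
    arithmetic-geometric inequality takes the place of Cauchy-Schwarz. *)
Lemma van_der_corput (f : nat -> R) :
  (forall i j, i <> j -> Mean (fun n => cos (f (n + i)%nat - f (n + j)%nat)) 0) ->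
  Mean (fun n => cos (f n)) 0.
Proof.
intros H; apply Mean_zero_of_abs_le; intros eps He.
(* [P > 1 / eps^2] makes the final mean [1 / (2 eps P) + eps / 2] smaller than [eps]. *)
destruct (exists_INR_S_gt (/ (eps * eps))) as [M HM].
set (P := INR (S M)) in *.
assert (HP : 0 < P) by apply INR_S_pos.
set (X := fun n => sum_f_R0 (fun i => cos (f (n + i)%nat)) M).
set (Y := fun n => sum_f_R0 (fun i => sin (f (n + i)%nat)) M).
(* Subtracting this mean-zero correction from [cos (f n)] leaves exactly the window average
   [X n / P]. *)
exists (fun n => - / P * sum_f_R0 (fun i => cos (f (n + i)%nat) - cos (f n)) M).
exists (fun n => / (2 * eps * P²) * ((X n)² + (Y n)²) + eps / 2).
exists (/ (2 * eps * P²) * P + eps / 2).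
repeat split.
- replace 0 with (- / P * sum_f_R0 (fun _ => 0) M) by (rewrite sum_cte; ring).
  apply Mean_scal, (Mean_sum (fun i n => cos (f (n + i)%nat) - cos (f n))).
  intros i _; apply (Mean_bounded_shift_diff (fun n => cos (f n))).
  intros; apply Rabs_cos_le_1.
- apply Mean_plus; [|apply Mean_const].
  apply Mean_scal, (Mean_cos_sin_sum_sq (fun n i => f (n + i)%nat)); auto.
- assert (E : / (2 * eps * P²) * P = / (2 * eps * P)) by (unfold Rsqr; field; lra).
  rewrite E.
  assert (/ (2 * eps * P) < eps / 2); [|lra].
  apply Rmult_lt_reg_l with (2 * eps * P); [nra|].
  rewrite Rinv_r by nra.
  apply Rmult_lt_compat_l with (r := eps * eps) in HM; [|nra].
  rewrite Rinv_r in HM; nra.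
- intros n.
  assert (E : cos (f n) - - / P * sum_f_R0 (fun i => cos (f (n + i)%nat) - cos (f n)) M
              = X n / P).
  { rewrite minus_sum, sum_cte; fold P (X n); field; lra. }
  rewrite E.
  (* The two squares give [|z| <= z^2 / (2 eps) + eps / 2] for [z = X n / P]; the term in [Y] only
     enlarges the bound. *)
  assert (Ha : 0 <= (X n / P - eps)²) by apply Rle_0_sqr.
  assert (Hb : 0 <= (X n / P + eps)²) by apply Rle_0_sqr.
  assert (Hy : 0 <= / (2 * eps * P²) * (Y n)²).
  { apply Rmult_le_pos; [|apply Rle_0_sqr].
    apply Rlt_le, Rinv_0_lt_compat; unfold Rsqr; apply Rmult_lt_0_compat; nra. }
  assert (E2 : / (2 * eps * P²) * (X n)² = (X n / P)² / (2 * eps))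
    by (unfold Rsqr; field; lra).
  rewrite Rmult_plus_distr_l, E2; set (z := X n / P) in *.
  assert (E3 : z ² / (2 * eps) + eps / 2 = (z² + eps * eps) / (2 * eps)) by (field; lra).
  assert (Rabs z <= z ² / (2 * eps) + eps / 2); [|lra].
  rewrite E3; apply Rle_div_r; [lra|].
  unfold Rsqr in *; unfold Rabs; destruct (Rcase_abs z); nra.
Qed.

(** * Forward differences *)

(** Differencing the argument first makes [diffs (S h) f] convertible to [diffs h] of the increments
    of [f], the form used in the inductions on [h]. *)
Fixpoint diffs (h : nat) (f : nat -> R) : nat -> R :=
  match h with
  | 0%nat => f
  | S h => diffs h (fun n => f (S n) - f n)
  end.

Lemma diffs_ext h f g n : (forall m, f m = g m) -> diffs h f n = diffs h g n.
Proof.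
revert f g; induction h as [|h IH]; simpl; intros f g H; [apply H|].
apply IH; intros m; now rewrite !H.
Qed.

Lemma diffs_plus h f g n :
  diffs h (fun m => f m + g m) n = diffs h f n + diffs h g n.
Proof.
revert f g; induction h as [|h IH]; simpl; intros f g; [reflexivity|].
rewrite <- IH; apply diffs_ext; intros; ring.
Qed.

Lemma diffs_scal h x f n : diffs h (fun m => x * f m) n = x * diffs h f n.
Proof.
revert f; induction h as [|h IH]; simpl; intros f; [reflexivity|].
rewrite <- IH; apply diffs_ext; intros; ring.
Qed.

Lemma diffs_shift h k f n : diffs h (fun m => f (m + k)%nat) n = diffs h f (n + k)%nat.
Proof.
revert f; induction h as [|h IH]; simpl; intros f; [reflexivity|].
apply (IH (fun m => f (S m) - f m)).
Qed.

(* The growth condition of Fejer's theorem and its extension by van der Corput,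
   for the forward differences of a sequence.  Only the comparison sequence [g]
   is monotone; the fixed ratio [lam] makes the class stable under sums. *)
Definition slow (lam : R) (u : nat -> R) : Prop :=
  exists g : nat -> R,
    eventually (fun n => 0 < g n /\ g (S n) <= g n) /\
    is_lim_seq g 0 /\
    is_lim_seq (fun n => INR n * g n) p_infty /\
    is_lim_seq (fun n => u n / g n) lam.

Lemma slow_ext lam u v : (forall n, u n = v n) -> slow lam u -> slow lam v.
Proof.
intros H (g & H1 & H2 & H3 & H4); exists g; repeat split; auto.
revert H4; apply is_lim_seq_ext; intros n; now rewrite H.
Qed.

Lemma slow_scal x lam u : slow lam u -> slow (x * lam) (fun n => x * u n).
Proof.
intros (g & H1 & H2 & H3 & H4); exists g; repeat split; auto.
eapply is_lim_seq_ext; [|exact (is_lim_seq_scal_l _ x _ H4)].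
intros n; unfold Rdiv; ring.
Qed.

Lemma slow_S lam u : slow lam u -> slow lam (fun n => u (S n)).
Proof.
intros (g & [N H1] & H2 & H3 & H4); exists (fun n => g (S n)).
repeat split.
- exists N; intros n Hn; apply H1; lia.
- now apply (is_lim_seq_incr_1 g).
- apply (is_lim_seq_incr_1 (fun n => INR n * g n)) in H3.
  apply (is_lim_seq_incr_1 g) in H2.
  (* The weight is [n], not [n + 1]; the discrepancy [g (n + 1)] tends to 0. *)
  apply is_lim_seq_ext with (fun n => INR (S n) * g (S n) - g (S n)).
  + intros n; rewrite S_INR; ring.
  + now eapply is_lim_seq_minus; [exact H3|exact H2|].
- now apply (is_lim_seq_incr_1 (fun n => u n / g n)).
Qed.

Lemma slow_shift k lam u : slow lam u -> slow lam (fun n => u (n + k)%nat).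
Proof.
induction k as [|k IH]; intros H.
- revert H; apply slow_ext; intros; f_equal; lia.
- apply IH, slow_S in H; revert H; apply slow_ext; intros; f_equal; lia.
Qed.

(** With comparison sequence [g + g'], the new ratio is a convex combination of [u / g] and
    [v / g']. Both tend to the same [lam], hence so does any such combination. *)
Lemma slow_plus lam u v : slow lam u -> slow lam v -> slow lam (fun n => u n + v n).
Proof.
intros (g & Hg & H2 & H3 & H4) (g' & Hg' & H2' & H3' & H4').
exists (fun n => g n + g' n); repeat split.
- generalize (filter_and _ _ Hg Hg'); apply filter_imp; intros n; lra.
- rewrite <- (Rplus_0_l 0); now apply is_lim_seq_plus'.
- eapply is_lim_seq_ext; [|eapply (is_lim_seq_plus _ _ _ _ p_infty H3 H3'); reflexivity].
  intros n; simpl; ring.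
- assert (E : is_lim_seq (fun n => Rabs (u n / g n - lam) + Rabs (v n / g' n - lam)) 0).
  { rewrite <- (Rplus_0_l 0).
    assert (Z : forall w, is_lim_seq w lam -> is_lim_seq (fun n => Rabs (w n - lam)) 0).
    { intros w Hw; apply -> is_lim_seq_abs_0; rewrite <- (Rminus_diag lam).
      apply is_lim_seq_minus'; [exact Hw|apply is_lim_seq_const]. }
    apply is_lim_seq_plus'; now apply Z. }
  apply is_lim_seq_ext with
    (fun n => ((u n + v n) / (g n + g' n) - lam) + lam); [intros; ring|].
  replace (Finite lam) with (Finite (0 + lam)) by (f_equal; ring).
  apply is_lim_seq_plus'; [|apply is_lim_seq_const].
  apply is_lim_seq_abs_0.
  apply (is_lim_seq_le_le_loc (fun _ => 0) _
     (fun n => Rabs (u n / g n - lam) + Rabs (v n / g' n - lam)));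
    [|apply is_lim_seq_const|exact E].
  generalize (filter_and _ _ Hg Hg'); apply filter_imp; intros n [[P _] [P' _]].
  split; [apply Rabs_pos|].
  replace ((u n + v n) / (g n + g' n) - lam) with
    (g n / (g n + g' n) * (u n / g n - lam) + g' n / (g n + g' n) * (v n / g' n - lam))
    by (field; lra).
  assert (Q : 0 < / (g n + g' n)) by (apply Rinv_0_lt_compat; lra).
  assert (W : g n / (g n + g' n) + g' n / (g n + g' n) = 1) by (field; lra).
  assert (W1 : 0 < g n / (g n + g' n)) by (apply Rmult_lt_0_compat; lra).
  assert (W2 : 0 < g' n / (g n + g' n)) by (apply Rmult_lt_0_compat; lra).
  eapply Rle_trans; [apply Rabs_triang|].
  rewrite !Rabs_mult, (Rabs_pos_eq (g n / _)), (Rabs_pos_eq (g' n / _)) by lra.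
  generalize (Rabs_pos (u n / g n - lam)) (Rabs_pos (v n / g' n - lam)); nra.
Qed.

(** The difference over a gap of [k + 1] telescopes into [k + 1] shifted increments of [f]. Their
    number is absorbed by the comparison sequence, so [lam] is unchanged and stays nonzero. *)
Lemma slow_diffs_shift_diff h lam f i k :
  slow lam (diffs (S h) f) ->
  slow lam (diffs h (fun n => f (n + (i + S k))%nat - f (n + i)%nat)).
Proof.
intros H; induction k as [|k IH].
- apply slow_shift with (k := i) in H; revert H; apply slow_ext; intros n.
  simpl; rewrite <- (diffs_shift h i (fun n => f (S n) - f n)).
  apply diffs_ext; intros m; do 2 f_equal; lia.
- apply slow_shift with (k := (i + S k)%nat) in H.
  generalize (slow_plus _ _ _ IH H); apply slow_ext; intros n.
  simpl; rewrite <- (diffs_shift h (i + S k) (fun n => f (S n) - f n)).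
  rewrite <- diffs_plus; apply diffs_ext; intros m.
  replace (m + (i + S (S k)))%nat with (S (m + (i + S k))) by lia; ring.
Qed.

(** * Fejer's theorem and its extension to higher differences *)

Lemma Rabs_cos_minus_le x y : Rabs (cos x - cos y) <= Rabs (x - y).
Proof.
destruct (MVT_abs cos (fun x => - sin x) y x) as [c [H _]];
  [intros; apply derivable_pt_lim_cos|].
rewrite H, Rabs_Ropp; generalize (Rabs_sin_le_1 c) (Rabs_pos (x - y)); nra.
Qed.

Lemma sin_plus_approx x d : Rabs (sin (x + d) - sin x - d * cos x) <= d * d.
Proof.
destruct (MVT_gen sin x (x + d) cos) as [c [Hc H]].
- intros; apply is_derive_Reals, derivable_pt_lim_sin.
- intros; apply continuity_sin.
- rewrite H.
  replace (cos c * (x + d - x) - d * cos x) with (d * (cos c - cos x)) by ring.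
  rewrite Rabs_mult.
  assert (Rabs (c - x) <= Rabs d).
  { revert Hc; unfold Rmin, Rmax, Rabs; destruct (Rle_dec x (x + d)), (Rcase_abs (c - x)), (Rcase_abs d); lra. }
  generalize (Rabs_cos_minus_le c x) (Rabs_pos d); intros.
  replace (d * d) with (Rabs d * Rabs d) by (rewrite <- Rabs_mult; apply Rabs_pos_eq; nra).
  apply Rmult_le_compat_l; lra.
Qed.

(* Summation by parts: the increments of [S_N - v (N + 1) * w N] telescope in
   absolute value because [w] is monotone. *)
Lemma sum_diff_mult_bound (v w : nat -> R) N0 :
  (forall n, Rabs (v n) <= 1) ->
  (forall n, (N0 <= n)%nat -> 0 < w n <= w (S n)) ->
  exists C, forall N, (N0 <= N)%nat ->
    Rabs (sum_f_R0 (fun n => (v (S n) - v n) * w n) N) <= C + 2 * w N.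
Proof.
intros Hv Hw; set (Sm := sum_f_R0 (fun n => (v (S n) - v n) * w n)).
exists (Rabs (Sm N0 - v (S N0) * w N0)).
assert (H : forall N, (N0 <= N)%nat -> Rabs (Sm N - v (S N) * w N) <=
   Rabs (Sm N0 - v (S N0) * w N0) + (w N - w N0)).
{ intros N HN; induction HN as [|N HN IH]; [lra|].
  replace (Sm (S N) - v (S (S N)) * w (S N)) with
    ((Sm N - v (S N) * w N) - v (S N) * (w (S N) - w N)) by (unfold Sm; simpl; ring).
  specialize (Hw N HN); specialize (Hv (S N)).
  eapply Rle_trans; [apply Rabs_triang|]; rewrite Rabs_Ropp, Rabs_mult.
  rewrite (Rabs_pos_eq (w (S N) - w N)) by lra.
  assert (Rabs (v (S N)) * (w (S N) - w N) <= 1 * (w (S N) - w N))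
    by (apply Rmult_le_compat_r; lra).
  lra. }
intros N HN; specialize (H N HN).
pose proof (Hw N HN); pose proof (Hw N0 (le_n _)).
replace (Sm N) with ((Sm N - v (S N) * w N) + v (S N) * w N) by ring.
eapply Rle_trans; [apply Rabs_triang|]; rewrite Rabs_mult, (Rabs_pos_eq (w N)) by lra.
assert (Rabs (v (S N)) * w N <= 1 * w N) by (apply Rmult_le_compat_r; [lra|apply Hv]).
lra.
Qed.

Lemma Mean_diff_mult (v w : nat -> R) :
  (forall n, Rabs (v n) <= 1) ->
  eventually (fun n => 0 < w n <= w (S n)) ->
  is_lim_seq (fun n => w n / INR (S n)) 0 ->
  Mean (fun n => (v (S n) - v n) * w n) 0.
Proof.
intros Hv [N0 Hw] Hl.
destruct (sum_diff_mult_bound v w N0 Hv Hw) as [C HC].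
apply is_lim_seq_abs_0.
apply (is_lim_seq_le_le_loc (fun _ => 0) _
  (fun N => C * / INR (S N) + 2 * (w N / INR (S N)))); [|apply is_lim_seq_const|].
- exists N0; intros N HN; split; [apply Rabs_pos|].
  assert (Hi := Rinv_0_lt_compat _ (INR_S_pos N)).
  unfold Rdiv; rewrite Rabs_mult, (Rabs_pos_eq (/ _)) by lra.
  specialize (HC N HN); nra.
- replace (Finite 0) with (Finite (C * 0 + 2 * 0)) by (f_equal; ring).
  apply is_lim_seq_plus'.
  + apply (is_lim_seq_scal_l _ C 0), (is_lim_seq_inv _ p_infty); [|discriminate].
    apply (is_lim_seq_incr_1 INR), is_lim_seq_INR.
  + apply (is_lim_seq_scal_l _ 2 0), Hl.
Qed.

(* With [d = f (n + 1) - f n ~ lam * g n], the value [cos (f n)] is the increment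
   of [sin o f] divided by [lam * g n], up to [o(1)]. *)
Lemma Mean_cos_slow_diff lam f :
  lam <> 0 -> slow lam (fun n => f (S n) - f n) -> Mean (fun n => cos (f n)) 0.
Proof.
intros Hlam (g & Hg & H2 & H3 & H4).
set (T := fun n => (sin (f (S n)) - sin (f n)) * / g n).
assert (HT : Mean T 0).
{ apply (Mean_diff_mult (fun n => sin (f n)) (fun n => / g n)).
  - intros; apply Rabs_sin_le_1.
  - destruct Hg as [N0 Hg]; exists N0; intros n Hn.
    destruct (Hg n Hn), (Hg (S n)); [lia|].
    split; [now apply Rinv_0_lt_compat|apply Rinv_le_contravar; lra].
  (* Here [n * g n -> oo] enters: it makes the boundary term of the summation by parts [o(N)]. *)
  - apply is_lim_seq_ext with (fun n => / (INR n * g n + g n)).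
    { intros n; rewrite S_INR; unfold Rdiv; rewrite <- Rinv_mult; f_equal; ring. }
    apply (is_lim_seq_inv _ p_infty); [|discriminate].
    now eapply is_lim_seq_plus; [exact H3|exact H2|]. }
apply Mean_ext with (fun n => / lam * T n + (cos (f n) - / lam * T n)); [intros; ring|].
replace 0 with (/ lam * 0 + 0) by ring.
apply Mean_plus; [now apply Mean_scal|]; apply Mean_lim.
(* The error splits into the deviation of [r n / lam] from 1 and the second-order remainder of the
   sine, bounded through [r n * r n * g n / lam]; both tend to 0. *)
set (r := fun n => (f (S n) - f n) / g n) in *.
assert (Hr : is_lim_seq (fun n => Rabs (1 - / lam * r n)) 0).
{ apply -> is_lim_seq_abs_0; replace (Finite 0) with (Finite (1 - / lam * lam))
    by (f_equal; field; auto).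
  apply is_lim_seq_minus'; [apply is_lim_seq_const|].
  apply (is_lim_seq_scal_l _ (/ lam) lam), H4. }
assert (Hd : is_lim_seq (fun n => Rabs (/ lam * (r n * r n * g n))) 0).
{ apply -> is_lim_seq_abs_0; replace (Finite 0) with (Finite (/ lam * (lam * lam * 0)))
    by (f_equal; ring).
  apply (is_lim_seq_scal_l _ (/ lam) (lam * lam * 0)).
  apply is_lim_seq_mult'; [apply is_lim_seq_mult'; exact H4|exact H2]. }
apply is_lim_seq_abs_0.
apply (is_lim_seq_le_le_loc (fun _ => 0) _
  (fun n => Rabs (1 - / lam * r n) + Rabs (/ lam * (r n * r n * g n))));
  [|apply is_lim_seq_const|].
- revert Hg; apply filter_imp; intros n [P _]; split; [apply Rabs_pos|].
  assert (E : f (S n) = f n + r n * g n) by (unfold r; field; lra).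
  set (x := f n) in *; set (d := r n * g n) in *.
  assert (Hs := sin_plus_approx x d).
  unfold T; fold x; rewrite E.
  replace (cos x - / lam * ((sin (x + d) - sin x) * / g n)) with
    ((1 - / lam * r n) * cos x + - (/ lam * / g n * (sin (x + d) - sin x - d * cos x)))
    by (unfold d; field; lra).
  eapply Rle_trans; [apply Rabs_triang|]; apply Rplus_le_compat.
  + rewrite Rabs_mult; generalize (Rabs_cos_le_1 x) (Rabs_pos (1 - / lam * r n)); nra.
  + rewrite Rabs_Ropp.
    replace (/ lam * (r n * r n * g n)) with (/ lam * / g n * (d * d))
      by (unfold d; field; lra).
    rewrite !(Rabs_mult (/ lam * / g n)); apply Rmult_le_compat_l; [apply Rabs_pos|].
    rewrite (Rabs_pos_eq (d * d)) by nra; exact Hs.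
- rewrite <- (Rplus_0_l 0); now apply is_lim_seq_plus'.
Qed.

Lemma Mean_cos_slow_diffs h lam f :
  lam <> 0 -> slow lam (diffs (S h) f) -> Mean (fun n => cos (f n)) 0.
Proof.
intros Hlam; revert f; induction h as [|h IH]; intros f Hf.
- now apply (Mean_cos_slow_diff lam).
- apply van_der_corput.
  (* It suffices to treat a later index minus an earlier one, since cosine is even. *)
  assert (W : forall i k, Mean (fun n => cos (f (n + (i + S k))%nat - f (n + i)%nat)) 0).
  { intros i k; apply (IH (fun n => f (n + (i + S k))%nat - f (n + i)%nat)).
    now apply slow_diffs_shift_diff. }
  intros i j Hij; destruct (Nat.lt_total i j) as [L|[L|L]]; [|lia|].
  + generalize (W i (j - S i)%nat); apply Mean_ext; intros n.
    rewrite <- cos_neg; f_equal; replace (i + S (j - S i))%nat with j by lia; ring.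
  + generalize (W j (i - S j)%nat); apply Mean_ext; intros n.
    now replace (j + S (i - S j))%nat with i by lia.
Qed.

Lemma slow_diffs_scal_plus h lam x y f :
  slow lam (diffs (S h) f) -> slow (x * lam) (diffs (S h) (fun n => x * f n + y)).
Proof.
intros H; apply slow_scal with (x := x) in H; revert H; apply slow_ext; intros n.
rewrite <- diffs_scal; simpl; apply diffs_ext; intros; ring.
Qed.

(** * Divergence from a lower bound on differences *)

Lemma diffs_growth_1 f :
  eventually (fun n => 1 <= INR n * (f (S n) - f n)) -> is_lim_seq f p_infty.
Proof.
intros [N0 H].
(* Increments of at least [1 / n] dominate those of the logarithm, as [ln (1 + 1 / n) <= 1 / n]. *)
assert (L : forall N, (S N0 <= N)%nat -> f (S N0) - ln (INR (S N0)) + ln (INR N) <= f N).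
{ intros N HN; induction HN as [|N HN IH]; [lra|].
  assert (HN0 : 0 < INR N) by (apply lt_0_INR; lia).
  specialize (H N ltac:(lia)).
  assert (E : INR (S N) = INR N * (1 + / INR N)) by (rewrite S_INR; field; lra).
  assert (Hi := Rinv_0_lt_compat _ HN0).
  rewrite E, ln_mult by lra.
  assert (ln (1 + / INR N) <= / INR N).
  { rewrite <- (ln_exp (/ INR N)) at 2; apply ln_le; [lra|]; apply exp_ineq1_le. }
  assert (/ INR N <= f (S N) - f N); [|lra].
  apply Rmult_le_reg_l with (INR N); [lra|]; rewrite Rinv_r; lra. }
apply is_lim_seq_le_p_loc with (fun N => f (S N0) - ln (INR (S N0)) + ln (INR N)).
- exists (S N0); exact L.
- apply is_lim_seq_plus with (f (S N0) - ln (INR (S N0))) p_infty;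
    [apply is_lim_seq_const| |reflexivity].
  eapply filterlim_comp; [exact is_lim_seq_INR|apply is_lim_ln_p].
Qed.

(** The induction hypothesis, applied to the increments, makes them tend to infinity, which is more
    than the order-one case requires. *)
Lemma diffs_growth h f :
  eventually (fun n => 1 <= INR n * diffs (S h) f n) -> is_lim_seq f p_infty.
Proof.
revert f; induction h as [|h IH]; intros f H; apply diffs_growth_1; [exact H|].
generalize (IH _ H); intros L; apply is_lim_seq_spec in L; specialize (L 1).
generalize (filter_and _ _ L (ex_intro (fun N => forall n, (N <= n)%nat -> (1 <= n)%nat) 1%nat (fun n H => H))).
apply filter_imp; intros n [A1 A2]; apply le_INR in A2; simpl INR in A2; nra.
Qed.

Lemma slow_diffs_pos_growth h lam f :
  0 < lam -> slow lam (diffs (S h) f) -> is_lim_seq f p_infty.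
Proof.
intros Hlam (g & Hg & H2 & H3 & H4); apply (diffs_growth h).
assert (L : is_lim_seq (fun n => diffs (S h) f n / g n * (INR n * g n)) p_infty).
{ eapply is_lim_seq_mult; [exact H4|exact H3|]. simpl.
  apply is_Rbar_mult_sym, is_Rbar_mult_p_infty_pos; exact Hlam. }
apply is_lim_seq_spec in L; specialize (L 1).
generalize (filter_and _ _ L Hg); apply filter_imp; intros n [A1 [A2 _]].
replace (diffs (S h) f n / g n * (INR n * g n)) with (INR n * diffs (S h) f n) in A1
  by (field; lra).
lra.
Qed.

(** * From derivatives to forward differences *)

Definition deriv_chain (X : R) (h : nat) (phi : nat -> R -> R) : Prop :=
  forall m x, (m < h)%nat -> X <= x -> is_derive (phi m) x (phi (S m) x).

(** Carrying the derivatives as data gives closure under combinations and translation without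
    computing any [Derive_n] of the result. *)
Lemma deriv_chain_lin X h phi psi p q :
  deriv_chain X h phi -> deriv_chain X h psi ->
  deriv_chain X h (fun m x => p * phi m x + q * psi m x).
Proof.
intros H H' m x Hm Hx; specialize (H m x Hm Hx); specialize (H' m x Hm Hx).
now apply @is_derive_plus; apply is_derive_scal.
Qed.

Lemma deriv_chain_shift X h phi :
  deriv_chain X h phi -> deriv_chain X h (fun m x => phi m (x + 1)).
Proof.
intros H m x Hm Hx; specialize (H m (x + 1) Hm ltac:(lra)).
rewrite <- (Rmult_1_l (phi (S m) (x + 1))).
apply (is_derive_comp (phi m) (fun x => x + 1)); [exact H|].
auto_derive; [exact I|ring].
Qed.

(** Induction on [h]: the hypothesis for the chain [phi m (x + 1) - phi m x] yields a point [xi],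
    and the ordinary mean value theorem for [phi h] on [[xi, xi + 1]] yields the next derivative. *)
Lemma diffs_MVT X h phi n :
  deriv_chain X h phi -> X <= INR n ->
  exists xi, INR n <= xi <= INR n + INR h /\
    diffs h (fun k => phi 0%nat (INR k)) n = phi h xi.
Proof.
intros H Hn; revert phi H; induction h as [|h IH]; intros phi H.
- exists (INR n); simpl; split; [lra|reflexivity].
- destruct (IH (fun m x => 1 * phi m (x + 1) + (-1) * phi m x)) as [xi [Hxi E]].
  { assert (H' : deriv_chain X h phi) by (intros m x Hm; apply H; lia).
    apply (deriv_chain_lin X h (fun m x => phi m (x + 1)) phi); [|exact H'].
    now apply deriv_chain_shift. }
  destruct (MVT_gen (phi h) xi (xi + 1) (phi (S h))) as [c [Hc Ec]].
  + intros x; rewrite Rmin_left, Rmax_right by lra; intros; apply H; [lia|lra].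
  + intros x; rewrite Rmin_left, Rmax_right by lra; intros.
    apply derivable_continuous_pt; exists (phi (S h) x).
    apply is_derive_Reals, H; [lia|lra].
  + rewrite Rmin_left, Rmax_right in Hc by lra.
    exists c; rewrite S_INR; split; [lra|].
    replace (phi (S h) c) with (1 * phi h (xi + 1) + (-1) * phi h xi) by lra.
    rewrite <- E; cbn [diffs]; apply diffs_ext; intros k; rewrite S_INR; ring.
Qed.

Lemma deriv_chain_Derive_n h f :
  eventually_diff h f -> exists X, deriv_chain X h (Derive_n f).
Proof.
intros [X H]; exists (X + 1); intros m x Hm Hx.
apply (Derive_correct (Derive_n f m)), (H x ltac:(lra) (S m) Hm).
Qed.

(** The sign [s] makes [s * f] nonincreasing. A negative value would then keep all later ones away
    from the limit 0, and a zero value far out is excluded by [x * |f x| -> oo]. *)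
Lemma monotone_to_zero_sign f :
  eventually_monotone f -> is_lim f p_infty 0 ->
  is_lim (fun x => x * Rabs (f x)) p_infty p_infty ->
  exists s X, Rabs s = 1 /\
    forall x, X <= x -> 0 < s * f x /\ forall y, x <= y -> s * f y <= s * f x.
Proof.
intros [X0 Hm] H0 Hi.
apply is_lim_spec in Hi; destruct (Hi 0) as [X1 H1].
assert (Hs : exists s, Rabs s = 1 /\ forall x y, X0 <= x -> x <= y -> s * f y <= s * f x).
{ destruct Hm as [Hm|Hm]; [exists (-1)|exists 1]; split.
  1, 3: unfold Rabs; destruct Rcase_abs; lra.
  all: intros x y Hx Hy; specialize (Hm x y Hx Hy); lra. }
destruct Hs as [s [Hs Hmon]]; exists s, (Rmax X0 (Rmax X1 0 + 1)); split; [exact Hs|].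
intros x Hx.
pose proof (Rmax_l X0 (Rmax X1 0 + 1)); pose proof (Rmax_r X0 (Rmax X1 0 + 1)).
pose proof (Rmax_l X1 0); pose proof (Rmax_r X1 0).
split; [|intros y Hy; apply Hmon; lra].
assert (Hne : s * f x <> 0).
{ intros E; specialize (H1 x ltac:(lra)).
  assert (Rabs (f x) = 0) by (rewrite <- (Rmult_1_l (Rabs _)), <- Hs, <- Rabs_mult, E; apply Rabs_R0).
  nra. }
destruct (Rlt_or_le 0 (s * f x)) as [L|L]; [exact L|exfalso].
apply is_lim_spec in H0.
assert (Hp : 0 < - (s * f x)) by lra.
destruct (H0 (mkposreal _ Hp)) as [Y HY]; simpl in HY.
set (y := Rmax x (Y + 1)); pose proof (Rmax_l x (Y + 1)); pose proof (Rmax_r x (Y + 1)).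
specialize (HY y ltac:(unfold y; lra)); rewrite Rminus_0_r in HY.
specialize (Hmon x y ltac:(lra) ltac:(unfold y; lra)).
assert (E : Rabs (s * f y) = Rabs (f y)) by (rewrite Rabs_mult, Hs; ring).
rewrite <- E in HY; apply Rabs_def2 in HY; lra.
Qed.

Lemma eventually_INR_ge (X : R) : eventually (fun n => X <= INR n).
Proof.
generalize is_lim_seq_INR; intros H; apply is_lim_seq_spec in H.
generalize (H X); apply filter_imp; intros; lra.
Qed.

(** The comparison sequence is built from the differences of [c] itself, so [c] contributes exactly
    [s] to the ratio, and it only remains to see that the differences of [ln b] are negligible. *)
Lemma slow_diffs_of_good (b c : R -> R) (h : nat) :
  eventually_diff h c ->
  eventually_monotone (Derive_n c h) ->
  is_lim (Derive_n c h) p_infty 0 ->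
  is_lim (fun x => x * Rabs (Derive_n c h x)) p_infty p_infty ->
  eventually_diff h (fun x => ln (b x)) ->
  is_lim (fun x => Derive_n (fun t => ln (b t)) h x / Derive_n c h x) p_infty 0 ->
  exists lam, lam <> 0 /\
    slow lam (diffs h (fun n => c (INR n) + ln (b (INR n)))).
Proof.
intros Hc Hmon H0 Hi Hb Hr.
destruct (monotone_to_zero_sign _ Hmon H0 Hi) as (s & X0 & Hs & Hsg).
destruct (deriv_chain_Derive_n _ _ Hc) as [X1 Cc].
destruct (deriv_chain_Derive_n _ _ Hb) as [X2 Cb].
set (X := Rmax 1 (Rmax X0 (Rmax X1 X2))).
assert (HX : 1 <= X /\ X0 <= X /\ X1 <= X /\ X2 <= X).
{ unfold X; pose proof (Rmax_l 1 (Rmax X0 (Rmax X1 X2)));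
  pose proof (Rmax_r 1 (Rmax X0 (Rmax X1 X2)));
  pose proof (Rmax_l X0 (Rmax X1 X2)); pose proof (Rmax_r X0 (Rmax X1 X2));
  pose proof (Rmax_l X1 X2); pose proof (Rmax_r X1 X2); lra. }
assert (C1 : deriv_chain X h (Derive_n c)) by (intros m x Hm Hx; apply Cc; [lia|lra]).
assert (C2 : deriv_chain X h (Derive_n (fun t => ln (b t))))
  by (intros m x Hm Hx; apply Cb; [lia|lra]).
clear Cc Cb; set (ch := Derive_n c h) in *; set (bh := Derive_n (fun t => ln (b t)) h) in *.
assert (Hss : s * s = 1).
{ rewrite <- (Rabs_pos_eq (s * s)) by nra; rewrite Rabs_mult, Hs; ring. }
set (g := fun n => s * diffs h (fun k => c (INR k)) n).
assert (Hg : forall n, X <= INR n ->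
  exists xi, INR n <= xi <= INR n + INR h /\ g n = s * ch xi).
{ intros n Hn; destruct (diffs_MVT X h (Derive_n c) n C1 Hn) as [xi [Hxi E]].
  exists xi; split; [exact Hxi|unfold g, ch; rewrite <- E; reflexivity]. }
assert (Hgpos : forall n, X <= INR n -> 0 < g n).
{ intros n Hn; destruct (Hg n Hn) as [xi [Hxi ->]]; apply Hsg; lra. }
exists s; split; [intros ->; rewrite Rabs_R0 in Hs; lra|].
exists g; repeat split.
- generalize (eventually_INR_ge X); apply filter_imp; intros n Hn.
  split; [now apply Hgpos|].
  (* Monotonicity of [g] comes from a single mean value point for [s * (c x - c (x + 1))], whose
     [h]-th derivative is nonnegative. *)
  assert (C3 := deriv_chain_lin X h _ _ s (- s) C1 (deriv_chain_shift X h _ C1)).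
  destruct (diffs_MVT X h _ n C3 Hn) as [xi [Hxi E]].
  destruct (Hsg xi ltac:(lra)) as [_ Hle]; specialize (Hle (xi + 1) ltac:(lra)).
  assert (E2 : diffs h (fun k => s * Derive_n c 0 (INR k) + - s * Derive_n c 0 (INR k + 1)) n
     = g n - g (S n)).
  { rewrite diffs_plus, !diffs_scal; unfold g.
    rewrite <- Nat.add_1_r, <- (diffs_shift h 1 (fun k => c (INR k))).
    rewrite (diffs_ext h (fun m => Derive_n c 0 (INR m + 1)) (fun m => c (INR (m + 1)))).
    - simpl; ring.
    - intros m; rewrite Nat.add_1_r, S_INR; reflexivity. }
  rewrite E in E2; unfold ch in Hle; lra.
- apply is_lim_seq_spec; intros eps.
  apply is_lim_spec in H0; destruct (H0 eps) as [Y HY].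
  generalize (eventually_INR_ge (Rmax X (Y + 1))); apply filter_imp; intros n Hn.
  pose proof (Rmax_l X (Y + 1)); pose proof (Rmax_r X (Y + 1)).
  destruct (Hg n ltac:(lra)) as [xi [Hxi ->]]; specialize (HY xi ltac:(lra)).
  rewrite Rminus_0_r in *; rewrite Rabs_mult, Hs, Rmult_1_l; exact HY.
- apply is_lim_seq_spec; intros M.
  (* The factor 2 pays for [xi <= n + h <= 2 n]. *)
  apply is_lim_spec in Hi; destruct (Hi (2 * Rmax M 0)) as [Y HY].
  pose proof (Rmax_l M 0); pose proof (Rmax_r M 0).
  generalize (eventually_INR_ge (Rmax X (Rmax (Y + 1) (INR h)))); apply filter_imp.
  intros n Hn.
  pose proof (Rmax_l X (Rmax (Y + 1) (INR h))); pose proof (Rmax_r X (Rmax (Y + 1) (INR h))).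
  pose proof (Rmax_l (Y + 1) (INR h)); pose proof (Rmax_r (Y + 1) (INR h)).
  destruct (Hg n ltac:(lra)) as [xi [Hxi E]]; specialize (HY xi ltac:(lra)).
  pose proof (Hgpos n ltac:(lra)) as Hp.
  assert (E' : Rabs (ch xi) = g n).
  { rewrite <- (Rabs_pos_eq (g n)) by lra; rewrite E, Rabs_mult, Hs; ring. }
  rewrite E' in HY; nra.
- assert (Hbh : is_lim_seq (fun n => diffs h (fun k => ln (b (INR k))) n / g n) 0).
  { apply is_lim_seq_spec; intros eps; pose proof (cond_pos eps) as He.
    apply is_lim_spec in Hr.
    assert (He2 : 0 < eps / 2) by lra.
    destruct (Hr (mkposreal _ He2)) as [Y HY]; simpl in HY.
    generalize (eventually_INR_ge (Rmax X (Y + 1))); apply filter_imp; intros n Hn.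
    pose proof (Rmax_l X (Y + 1)); pose proof (Rmax_r X (Y + 1)).
    pose proof (Hgpos n ltac:(lra)) as Hp.
    assert (Hbd : forall xi, INR n <= xi -> Rabs (bh xi) <= eps / 2 * (s * ch xi)).
    { intros xi Hxi; specialize (HY xi ltac:(lra)); rewrite Rminus_0_r in HY.
      destruct (Hsg xi ltac:(lra)) as [Hpos _].
      assert (Hne : ch xi <> 0) by (intros Z; rewrite Z in Hpos; lra).
      assert (E' : Rabs (ch xi) = s * ch xi).
      { rewrite <- (Rabs_pos_eq (s * ch xi)) by lra; rewrite Rabs_mult, Hs; ring. }
      replace (bh xi) with (bh xi / ch xi * ch xi) by (field; exact Hne).
      rewrite Rabs_mult, E'; apply Rmult_le_compat_r; lra. }
    (* Separate mean value points for [ln b] and [c] could not be compared. One point for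
       [(eps / 2) * s * c - p * ln b], whose [h]-th derivative is nonnegative, settles both signs
       [p]. *)
    assert (P1 : forall p, Rabs p = 1 ->
       p * diffs h (fun k => ln (b (INR k))) n <= eps / 2 * g n).
    { intros p Hpp.
      assert (C3 := deriv_chain_lin X h _ _ (- p) (eps / 2 * s) C2 C1).
      destruct (diffs_MVT X h _ n C3 ltac:(lra)) as [xi [Hxi E]].
      rewrite diffs_plus, !diffs_scal in E; cbn [Derive_n] in E; fold bh ch in E.
      specialize (Hbd xi ltac:(lra)).
      assert (p * bh xi <= Rabs (bh xi)).
      { eapply Rle_trans; [apply Rle_abs|]; rewrite Rabs_mult, Hpp; lra. }
      unfold g; lra. }
    assert (A1 := P1 1 Rabs_R1).
    assert (A2 := P1 (-1) ltac:(unfold Rabs; destruct Rcase_abs; lra)).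
    rewrite Rminus_0_r; unfold Rdiv; rewrite Rabs_mult, (Rabs_pos_eq (/ _))
      by (apply Rlt_le, Rinv_0_lt_compat; lra).
    apply Rmult_lt_reg_r with (g n); [lra|].
    rewrite Rmult_assoc, Rinv_l by lra.
    apply Rle_lt_trans with (eps / 2 * g n); [|nra].
    rewrite Rmult_1_r; apply Rabs_le; lra. }
  replace (Finite s) with (Finite (s + 0)) by (f_equal; ring).
  eapply is_lim_seq_ext_loc; [|exact (is_lim_seq_plus' _ _ _ _ (is_lim_seq_const s) Hbh)].
  generalize (eventually_INR_ge X); apply filter_imp; intros n Hn.
  pose proof (Hgpos n ltac:(lra)) as Hp.
  rewrite diffs_plus; unfold Rdiv; rewrite Rmult_plus_distr_r; f_equal.
  replace (diffs h (fun k => c (INR k)) n) with (s * g n) by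
    (unfold g; rewrite <- Rmult_assoc, Hss; ring).
  field; lra.
Qed.

(** * Fejer kernels and equidistribution *)

Lemma cos_period_Z x z : cos (x + 2 * PI * IZR z) = cos x.
Proof.
assert (H : forall n y, cos (y + 2 * PI * INR n) = cos y).
{ intros n y; rewrite <- (cos_period y n); f_equal; ring. }
destruct (Z_le_gt_dec 0 z) as [Hz|Hz].
- rewrite <- (H (Z.to_nat z) x), INR_IZR_INZ, Z2Nat.id by lia; reflexivity.
- rewrite <- (H (Z.to_nat (- z)) (x + _)), INR_IZR_INZ, Z2Nat.id by lia.
  f_equal; rewrite opp_IZR; ring.
Qed.

(** The factor [2 * sin (y / 2)] makes the sum telescope; keeping it on the left avoids dividing by
    a possible zero. *)
Lemma sum_cos_progression x y M :
  2 * sin (y / 2) * sum_f_R0 (fun l => cos (x - INR l * y)) M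
  = sin (x + y / 2) - sin (x - INR M * y - y / 2).
Proof.
induction M as [|M IH].
- simpl; rewrite !Rmult_0_l, Rminus_0_r, sin_plus, sin_minus; ring.
- rewrite tech5, Rmult_plus_distr_l, IH, S_INR.
  replace (x - INR M * y - y / 2) with ((x - (INR M + 1) * y) + y / 2) by field.
  rewrite (sin_plus (x - _)), (sin_minus (x - (INR M + 1) * y)); ring.
Qed.

(** The ends of the telescoped sum differ by [2 * PI * m], while the factor [sin (PI * m / (M + 1))]
    is nonzero. *)
Lemma sum_cos_roots_of_unity x m M :
  (0 < m < S M)%nat ->
  sum_f_R0 (fun l => cos (x - INR l * (2 * PI * INR m / INR (S M)))) M = 0.
Proof.
intros Hm; pose proof (INR_S_pos M) as HP; pose proof PI_RGT_0.
assert (H1 := sum_cos_progression x (2 * PI * INR m / INR (S M)) M).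
set (a := 2 * PI * INR m / INR (S M)) in *.
assert (Hm0 : 0 < INR m) by (apply lt_0_INR; lia).
assert (Hm1 : INR m < INR (S M)) by (apply lt_INR; lia).
assert (Ea : a / 2 = PI * (INR m / INR (S M))) by (unfold a; field; lra).
assert (Hq : 0 < INR m / INR (S M) < 1).
{ split; [now apply Rdiv_lt_0_compat|apply Rlt_div_l; lra]. }
assert (Hs : 0 < sin (a / 2)) by (apply sin_gt_0; rewrite Ea; nra).
assert (E : sin (x - INR M * a - a / 2) = sin (x + a / 2)).
{ replace (x + a / 2) with ((x - INR M * a - a / 2) + 2 * INR m * PI).
  - now rewrite sin_period.
  - unfold a; rewrite !S_INR in *; field; lra. }
rewrite E in H1; nra.
Qed.

(* [M + 1] times the usual Fejer kernel: the squared modulus of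
   [sum_(k <= M) exp (i k t)]. *)
Definition fejer (M : nat) (t : R) : R :=
  (sum_f_R0 (fun k => cos (INR k * t)) M)² + (sum_f_R0 (fun k => sin (INR k * t)) M)².

Lemma fejer_nonneg M t : 0 <= fejer M t.
Proof. apply Rplus_le_le_0_compat; apply Rle_0_sqr. Qed.

(** Away from multiples of [2 * PI] the kernel is bounded independently of [M]: with
    [s = sin (- t / 2)], the squares of both sums are at most [1 / s^2], and [s^2 >= eta / 2]. *)
Lemma fejer_le M t eta : 0 < eta -> cos t <= 1 - eta -> fejer M t <= 4 / eta.
Proof.
intros He Ht; unfold fejer.
assert (H1 := sum_cos_progression 0 (- t) M).
(* The phase [- PI / 2] turns the cosine sum into the sine sum. *)
assert (H2 := sum_cos_progression (- (PI / 2)) (- t) M).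
rewrite (sum_eq _ (fun k => cos (INR k * t))) in H1
  by (intros i _; f_equal; ring).
rewrite (sum_eq _ (fun k => sin (INR k * t))) in H2.
2: { intros i _; rewrite <- cos_shift, <- (cos_neg (_ - _)); f_equal; ring. }
set (C := sum_f_R0 (fun k => cos (INR k * t)) M) in *.
set (D := sum_f_R0 (fun k => sin (INR k * t)) M) in *.
set (s := sin (- t / 2)) in *.
assert (Es : 2 * (s * s) = 1 - cos t).
{ replace t with (2 * (t / 2)) at 1 by field; rewrite cos_2a_sin; unfold s.
  replace (- t / 2) with (- (t / 2)) by field; rewrite sin_neg; ring. }
assert (Q : forall p q r, 2 * s * r = sin p - sin q -> s * s * (r * r) <= 1).
{ intros p q r E; pose proof (SIN_bound p); pose proof (SIN_bound q).
  replace (s * s * (r * r)) with ((2 * s * r) * (2 * s * r) / 4) by field.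
  rewrite E; nra. }
apply Q in H1; apply Q in H2.
apply Rle_div_r; [lra|]; unfold Rsqr.
pose proof (Rle_0_sqr C); pose proof (Rle_0_sqr D); unfold Rsqr in *; nra.
Qed.

(** All frequencies [i - j] have modulus at most [M], so the nonzero ones cancel over [M + 1]
    equally spaced points. Divided by [(M + 1)^2], the kernels form a partition of unity. *)
Lemma fejer_grid_sum M t :
  sum_f_R0 (fun l => fejer M (t - INR l * (2 * PI / INR (S M)))) M
  = INR (S M) * INR (S M).
Proof.
set (a := 2 * PI / INR (S M)); pose proof (INR_S_pos M) as HP.
unfold fejer.
rewrite (sum_eq _ (fun l => sum_f_R0 (fun i => sum_f_R0 (fun j =>
  cos (INR i * (t - INR l * a) - INR j * (t - INR l * a))) M) M));
  [|intros l _; apply (cos_sin_sum_sq (fun i => INR i * (t - INR l * a)))].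
rewrite sum_swap, <- sum_diag; apply sum_eq; intros i Hi.
rewrite sum_swap; apply sum_eq; intros j Hj.
assert (W : forall p k, (p + S k <= M)%nat ->
  sum_f_R0 (fun l => cos (INR (p + S k) * (t - INR l * a) - INR p * (t - INR l * a))) M = 0).
{ intros p k Hk; rewrite <- (sum_cos_roots_of_unity (INR (S k) * t) (S k) M) by lia.
  apply sum_eq; intros l _; f_equal; rewrite plus_INR; unfold a; field; lra. }
destruct (Nat.eqb_spec i j) as [->|Hij].
- rewrite (sum_eq _ (fun _ => 1)); [rewrite sum_cte; ring|].
  intros; now rewrite Rminus_diag, cos_0.
- destruct (Nat.lt_total i j) as [L|[L|L]]; [|lia|].
  + rewrite <- (W i (j - S i)%nat) by lia; apply sum_eq; intros l _.
    replace (i + S (j - S i))%nat with j by lia.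
    rewrite <- cos_neg; f_equal; ring.
  + rewrite <- (W j (i - S j)%nat) by lia; apply sum_eq; intros l _.
    now replace (j + S (i - S j))%nat with i by lia.
Qed.

Lemma sum_indicator_le y M : 0 <= y ->
  sum_f_R0 (fun l => if Rle_dec (INR l) y then 1 else 0) M <= y + 1.
Proof.
intros Hy; induction M as [|M IH]; [simpl; destruct Rle_dec; lra|].
rewrite tech5; destruct (Rle_dec (INR (S M)) y) as [L|L]; [|lra].
assert (sum_f_R0 (fun l => if Rle_dec (INR l) y then 1 else 0) M <= sum_f_R0 (fun _ => 1) M)
  by (apply sum_Rle; intros; destruct Rle_dec; lra).
rewrite sum_cte in *; lra.
Qed.

Definition arc (alpha beta t : R) : Prop :=
  exists z : Z, alpha + IZR z <= t < beta + IZR z.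

Lemma cos_le_of_dist (delta d : R) :
  0 <= delta -> delta <= d <= 1 - delta -> cos (2 * PI * d) <= cos (2 * PI * delta).
Proof.
intros H0 H; pose proof PI_RGT_0.
destruct (Rle_or_lt d (1 / 2)).
- apply cos_decr_1; nra.
- replace (cos (2 * PI * d)) with (cos (2 * PI * (1 - d))).
  + apply cos_decr_1; nra.
  + rewrite <- (cos_period_Z (2 * PI * d) (-1)), <- cos_neg; f_equal; ring.
Qed.

(** The free phase [phi] lets cosines alone stand for the complex exponential sums, and absorbs
    translations of [g]. *)
Definition weyl (g : nat -> R) : Prop :=
  forall m phi, (0 < m)%nat -> Mean (fun n => cos (2 * PI * INR m * g n + phi)) 0.

Lemma weyl_Mean_fejer g M s :
  weyl g -> Mean (fun n => fejer M (2 * PI * (g n - s))) (INR (S M)).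
Proof.
intros Hg; apply (Mean_cos_sin_sum_sq (fun n k => INR k * (2 * PI * (g n - s)))).
assert (W : forall p k, Mean (fun n => cos (INR (p + S k) * (2 * PI * (g n - s)) -
   INR p * (2 * PI * (g n - s)))) 0).
{ intros p k; generalize (Hg (S k) (- (2 * PI * INR (S k) * s)) ltac:(lia)).
  apply Mean_ext; intros n; f_equal; rewrite plus_INR; ring. }
intros i j _ _ Hij; destruct (Nat.lt_total i j) as [L|[L|L]]; [|lia|].
- generalize (W i (j - S i)%nat); apply Mean_ext; intros n.
  replace (i + S (j - S i))%nat with j by lia.
  rewrite <- cos_neg; f_equal; ring.
- generalize (W j (i - S j)%nat); apply Mean_ext; intros n.
  now replace (j + S (i - S j))%nat with i by lia.
Qed.

(* The majorant averages the Fejer kernels centred at the points of a grid of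
   step [1 / (M + 1)] that lie within [delta] of the arc. *)
Lemma weyl_arc_majorant g alpha beta (u : nat -> R) eps :
  weyl g -> alpha <= beta ->
  (forall n, u n <= 0 \/ (u n <= 1 /\ arc alpha beta (g n))) ->
  0 < eps ->
  exists v m, Mean v m /\ m < beta - alpha + eps /\ forall n, u n <= v n.
Proof.
intros Hg Hab Hu He; pose proof PI_RGT_0 as Hpi.
(* Widening the arc costs [2 * delta <= eps / 4]; the cap [1 / 4] keeps [2 * PI * delta] where
   cosine decreases. *)
set (delta := Rmin (eps / 8) (1 / 4)).
assert (Hd : 0 < delta <= eps / 8 /\ delta <= 1 / 4).
{ unfold delta; pose proof (Rmin_l (eps / 8) (1 / 4)); pose proof (Rmin_r (eps / 8) (1 / 4)).
  split; [split|]; auto; apply Rmin_glb_lt; lra. }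
set (eta := 1 - cos (2 * PI * delta)).
assert (Heta : 0 < eta).
{ assert (cos (2 * PI * delta) < cos 0) by (apply cos_decreasing_1; nra).
  rewrite cos_0 in *; unfold eta; lra. }
destruct (exists_INR_S_gt (2 * (4 / eta + 1) / eps)) as [M HM].
set (P := INR (S M)) in *; assert (HP : 0 < P) by apply INR_S_pos.
set (y := beta - alpha + 2 * delta).
set (w := fun l => if Rle_dec (INR l) (P * y) then 1 else 0).
set (K := fun l t => fejer M (2 * PI * (t - (alpha - delta + INR l / P)))).
(* The constant pays for the omitted kernels: at most [P] of them, each at most [4 / eta], divided
   by [P * P]. *)
exists (fun n => 4 / eta / P + / (P * P) * sum_f_R0 (fun l => w l * K l (g n)) M).
exists (4 / eta / P + / (P * P) * sum_f_R0 (fun l => w l * P) M).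
assert (HPP : 0 < / (P * P)) by (apply Rinv_0_lt_compat; nra).
repeat split.
- apply Mean_plus; [apply Mean_const|apply Mean_scal].
  apply (Mean_sum (fun l n => w l * K l (g n))); intros l _.
  now apply Mean_scal, weyl_Mean_fejer.
- assert (Hw : sum_f_R0 w M <= P * y + 1) by (apply sum_indicator_le; unfold y; nra).
  replace (sum_f_R0 (fun l => w l * P) M) with (P * sum_f_R0 w M) by apply scal_sum.
  replace (/ (P * P) * (P * sum_f_R0 w M)) with (sum_f_R0 w M / P) by (field; lra).
  assert (sum_f_R0 w M / P <= y + / P).
  { apply Rle_div_l; [lra|]; rewrite Rmult_plus_distr_r, Rinv_l; lra. }
  assert (4 / eta / P + / P < eps / 2).
  { replace (4 / eta / P + / P) with ((4 / eta + 1) / P) by (field; lra).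
    apply Rlt_div_l; [lra|]; apply Rlt_div_l in HM; lra. }
  unfold y in *; lra.
- intros n; set (t := g n).
  assert (Hw01 : forall l, 0 <= w l <= 1) by (intros l; unfold w; destruct Rle_dec; lra).
  assert (HK : forall l, 0 <= K l t) by (intros; apply fejer_nonneg).
  assert (H4 : 0 < 4 / eta) by (apply Rdiv_lt_0_compat; lra).
  destruct (Hu n) as [Hn|[Hn [z Hz]]].
  + assert (0 < 4 / eta / P) by (apply Rdiv_lt_0_compat; lra).
    assert (0 <= sum_f_R0 (fun l => w l * K l t) M).
    { apply cond_pos_sum; intros l; apply Rmult_le_pos; [apply Hw01|apply HK]. }
    nra.
  + fold t in Hz.
    assert (E : sum_f_R0 (fun l => K l t) M = P * P).
    { unfold P; rewrite <- (fejer_grid_sum M (2 * PI * (t - alpha + delta))).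
      apply sum_eq; intros l _; unfold K; f_equal; fold P; field; lra. }
    assert (Hs : sum_f_R0 (fun l => K l t) M <= sum_f_R0 (fun l => w l * K l t + 4 / eta) M).
    { apply sum_Rle; intros l Hl; unfold w; destruct (Rle_dec (INR l) (P * y)) as [L|L]; [lra|].
      assert (K l t <= 4 / eta); [|lra].
      apply fejer_le; [exact Heta|].
      (* An omitted grid point lies beyond the widened arc and at most one full turn from its start,
         so [d] is at distance at least [delta] from both 0 and 1. *)
      set (d := INR l / P - (t - alpha - IZR z) - delta).
      replace (cos _) with (cos (2 * PI * d)).
      2: { rewrite <- (cos_period_Z (2 * PI * d) (- z)), <- cos_neg; f_equal.
           unfold d; rewrite opp_IZR; ring. }
      unfold eta; replace (1 - (1 - cos (2 * PI * delta))) with (cos (2 * PI * delta)) by ring.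
      assert (L1 : y < INR l / P) by (apply Rlt_div_r; lra).
      assert (L2 : INR l / P <= 1).
      { apply Rle_div_l; [lra|]; rewrite Rmult_1_l; apply le_INR; lia. }
      apply cos_le_of_dist; unfold d, y in *; lra. }
    rewrite E, sum_plus, sum_cte in Hs; fold P in Hs.
    apply Rle_trans with (/ (P * P) * (P * P)); [rewrite Rinv_l; nra|].
    replace (4 / eta / P) with (/ (P * P) * (4 / eta * P)) by (field; lra).
    nra.
Qed.

(** The lower bound is the majorant for the complementary arc from [beta] to [alpha + 1], subtracted
    from 1. *)
Lemma weyl_equidistributed g alpha beta (u : nat -> R) :
  weyl g -> alpha <= beta <= alpha + 1 ->
  (forall n, (u n = 1 /\ arc alpha beta (g n)) \/ (u n = 0 /\ ~ arc alpha beta (g n))) ->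
  Mean u (beta - alpha).
Proof.
intros Hg Hab Hu; apply Mean_sandwich; intros eps He.
- apply (weyl_arc_majorant g); auto; [lra|].
  intros n; destruct (Hu n) as [[H1 H2]|[H1 H2]]; [right|left]; [split; auto|]; lra.
- destruct (weyl_arc_majorant g beta (alpha + 1) (fun n => 1 - u n) eps Hg)
    as (v & m & Hv & Hm & Hle); auto; [lra| |].
  + intros n; destruct (Hu n) as [[H1 H2]|[H1 H2]]; [left; lra|right; split; [lra|]].
    destruct (base_Int_part (g n - alpha)) as [F1 F2].
    exists (Int_part (g n - alpha)); split; [|lra].
    destruct (Rle_or_lt (beta + IZR (Int_part (g n - alpha))) (g n)); [auto|].
    exfalso; apply H2; exists (Int_part (g n - alpha)); lra.
  + exists (fun n => 1 + (-1) * v n), (1 + (-1) * m).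
    split; [apply Mean_plus; [apply Mean_const|now apply Mean_scal]|split; [lra|]].
    intros n; specialize (Hle n); simpl in Hle; lra.
Qed.

(** * First digits *)

Lemma mult_pow_le_iff_log (k x y : R) j :
  1 < k -> 0 < x -> 0 < y ->
  x * k ^ j <= y <-> log_base k x + INR j <= log_base k y.
Proof.
intros Hk Hx Hy; unfold log_base.
assert (Hl : 0 < ln k) by (rewrite <- ln_1; apply ln_increasing; lra).
assert (Hp : 0 < k ^ j) by (apply pow_lt; lra).
assert (E : ln (x * k ^ j) / ln k = ln x / ln k + INR j).
{ rewrite ln_mult, ln_pow by lra; field; lra. }
rewrite <- E; split; intros H.
- apply Rmult_le_compat_r; [now apply Rlt_le, Rinv_0_lt_compat|].
  apply ln_le; nra.
- apply Rmult_le_reg_r in H; [|now apply Rinv_0_lt_compat].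
  apply Rnot_lt_le; intros H'; apply ln_increasing in H'; nra.
Qed.

Lemma first_digits_iff_arc (k d m : Z) :
  (2 <= k)%Z -> (1 <= d)%Z -> (d + 1 <= m)%Z ->
  first_digits k d m <->
  arc (log_base (IZR k) (IZR d)) (log_base (IZR k) (IZR (d + 1)))
      (log_base (IZR k) (IZR m)).
Proof.
intros Hk Hd Hm.
assert (Hk' : 1 < IZR k) by (apply (IZR_lt 1); lia).
assert (Hd' : 0 < IZR d) by (apply (IZR_lt 0); lia).
assert (Hd1 : 0 < IZR (d + 1)) by (apply (IZR_lt 0); lia).
assert (Hm' : 0 < IZR m) by (apply (IZR_lt 0); lia).
assert (W : forall x j, (0 < x)%Z -> (x * k ^ Z.of_nat j <= m)%Z <->
   log_base (IZR k) (IZR x) + INR j <= log_base (IZR k) (IZR m)).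
{ intros x j Hx.
  rewrite <- mult_pow_le_iff_log by first [assumption | now apply (IZR_lt 0)].
  rewrite pow_IZR, <- mult_IZR; split; [apply IZR_le|apply le_IZR]. }
split.
- intros [j [H1 H2]]; exists (Z.of_nat j); rewrite <- INR_IZR_INZ; split.
  + apply W; lia.
  + apply Rnot_le_lt; intros H3; apply W in H3; lia.
- intros [z [H1 H2]].
  (* Since [m >= d + 1], the integer [z] given by the arc is positive and so is a legitimate
     exponent. *)
  assert (H3 : log_base (IZR k) (IZR (d + 1)) + INR 0 <= log_base (IZR k) (IZR m)).
  { apply W; [lia|simpl; lia]. }
  assert (Hz : (0 < z)%Z) by (apply lt_IZR; simpl in H3; lra).
  exists (Z.to_nat z).
  rewrite <- (Z2Nat.id z), <- INR_IZR_INZ in H1, H2 by lia; split.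
  + apply W; [lia|exact H1].
  + apply Z.nle_gt; intros H4; apply W in H4; [lra|lia].
Qed.

Lemma INR_length_filter_seq (p : nat -> bool) N :
  INR (length (filter p (seq 1 (S N)))) =
  sum_f_R0 (fun n => if p (S n) then 1 else 0) N.
Proof.
induction N as [|N IH]; [simpl; destruct (p 1%nat); reflexivity|].
rewrite seq_S, filter_app, length_app, plus_INR, IH, tech5; f_equal.
simpl; destruct (p (S (S N))); reflexivity.
Qed.

Lemma is_lim_B_of_Mean d k a L :
  Mean (fun n => if ((0 <? a (S n))%Z && first_digitsb k d (a (S n)))%bool then 1 else 0) L ->
  is_lim (fun x => B d x k a) p_infty L.
Proof.
intros H; set (p := fun n => ((0 <? a n)%Z && first_digitsb k d (a n))%bool).
(* A partial sum up to index [q x] has [q x + 1] terms, the floor of [x]. Dividing by [x] instead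
   costs a factor tending to 1. *)
set (q := fun x => Nat.pred (Z.to_nat (Int_part x))).
assert (Hq : forall x, 1 <= x -> Z.to_nat (Int_part x) = S (q x) /\
   x - 1 < INR (S (q x)) <= x).
{ intros x Hx; destruct (base_Int_part x) as [F1 F2].
  assert (Hz : (0 < Int_part x)%Z) by (apply lt_IZR; lra).
  assert (E : Z.to_nat (Int_part x) = S (q x)) by (unfold q; lia).
  split; [exact E|]; rewrite <- E, INR_IZR_INZ, Z2Nat.id by lia; lra. }
assert (L1 : is_lim (fun x => sum_f_R0 (fun n => if p (S n) then 1 else 0) (q x)
                              / INR (S (q x))) p_infty L).
{ apply (filterlim_comp _ _ _ q (fun N => sum_f_R0 (fun n => if p (S n) then 1 else 0) N
     / INR (S N)) _ eventually); [|exact H].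
  intros Q [N0 HN]; exists (INR N0 + 2); intros x Hx; apply HN.
  pose proof (pos_INR N0); destruct (Hq x ltac:(lra)) as [_ Hqx].
  rewrite S_INR in Hqx; apply INR_le; lra. }
assert (L2 : is_lim (fun x => INR (S (q x)) / x) p_infty 1).
{ apply (is_lim_le_le_loc (fun x => 1 - / x) (fun _ => 1)).
  - exists 1; intros x Hx; destruct (Hq x ltac:(lra)) as [_ Hqx].
    replace (1 - / x) with ((x - 1) / x) by (field; lra).
    assert (0 < / x) by (apply Rinv_0_lt_compat; lra).
    split; [apply Rmult_le_compat_r; lra|].
    apply Rle_div_l; [lra|]; rewrite Rmult_1_l; apply Hqx.
  - replace (Finite 1) with (Rbar_minus 1 0) by (simpl; f_equal; ring).
    apply is_lim_minus'; [apply is_lim_const|].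
    replace (Finite 0) with (Rbar_inv p_infty) by reflexivity.
    apply is_lim_inv; [apply is_lim_id|discriminate].
  - apply is_lim_const. }
replace (Finite L) with (Rbar_mult L 1) by (simpl; f_equal; ring).
eapply is_lim_ext_loc; [|apply (is_lim_mult _ _ _ _ _ L1 L2 I)].
exists 1; intros x Hx; destruct (Hq x ltac:(lra)) as [E Hqx]; simpl.
unfold B; rewrite E; fold p; rewrite INR_length_filter_seq.
field; split; [lra|apply Rgt_not_eq, INR_S_pos].
Qed.

(** * From good sequences to the Benford property *)

Lemma Mean_cos_perturb x y :
  is_lim_seq (fun n => x n - y n) 0 ->
  Mean (fun n => cos (y n)) 0 -> Mean (fun n => cos (x n)) 0.
Proof.
intros Hxy Hy.
apply Mean_ext with (fun n => cos (y n) + (cos (x n) - cos (y n))); [intros; ring|].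
rewrite <- (Rplus_0_l 0); apply Mean_plus; [exact Hy|apply Mean_lim].
apply is_lim_seq_abs_0; apply -> is_lim_seq_abs_0 in Hxy.
apply (is_lim_seq_le_le (fun _ => 0) _ (fun n => Rabs (x n - y n)));
  [|apply is_lim_seq_const|exact Hxy].
intros n; split; [apply Rabs_pos|apply Rabs_cos_minus_le].
Qed.

Lemma weyl_of_slow_diffs h lam f g x N :
  lam <> 0 -> x <> 0 -> slow lam (diffs (S h) f) ->
  is_lim_seq (fun n => g n - f n) 0 -> weyl (fun n => x * g (n + N)%nat).
Proof.
intros Hlam Hx Hf Hg m phi Hm.
set (r := 2 * PI * INR m * x).
assert (Hr : r <> 0).
{ assert (0 < INR m) by now apply lt_0_INR.
  apply Rmult_integral_contrapositive_currified; [|exact Hx].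
  pose proof PI_RGT_0; apply Rgt_not_eq; nra. }
apply Mean_cos_perturb with (fun n => r * f (n + N)%nat + phi).
- apply is_lim_seq_ext with (fun n => r * (g (n + N)%nat - f (n + N)%nat));
    [intros; unfold r; ring|].
  replace (Finite 0) with (Rbar_mult r 0) by (simpl; f_equal; ring).
  apply is_lim_seq_scal_l, (is_lim_seq_incr_n (fun n => g n - f n) N), Hg.
- apply (Mean_cos_slow_diffs h (r * lam)).
  + now apply Rmult_integral_contrapositive_currified.
  + apply slow_diffs_scal_plus; generalize (slow_shift N _ _ Hf).
    apply slow_ext; intros n; symmetry; apply diffs_shift.
Qed.

Lemma good_log (a : nat -> Z) : good a ->
  exists h lam f, lam <> 0 /\ slow lam (diffs (S h) f) /\
    eventually (fun n => (0 < a n)%Z) /\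
    is_lim_seq (fun n => ln (IZR (a n)) - f n) 0.
Proof.
intros (b & c & Hb & Ha & h & Hh & H1 & H2 & H3 & H4 & H5 & H6).
destruct h as [|h]; [lia|].
destruct (slow_diffs_of_good b c (S h) H1 H2 H3 H4 H5 H6) as [lam [Hlam Hf]].
exists h, lam, (fun n => c (INR n) + ln (b (INR n))).
assert (Hb' : eventually (fun n => 0 < b (INR n))).
{ destruct Hb as [X HX]; generalize (eventually_INR_ge (X + 1)); apply filter_imp.
  intros n Hn; apply HX; lra. }
assert (Hpos : eventually (fun n => 0 < IZR (a n) / (b (INR n) * exp (c (INR n))))).
{ apply is_lim_seq_spec in Ha; generalize (Ha (mkposreal 1 Rlt_0_1)); apply filter_imp.
  intros n Hn; simpl in Hn; apply Rabs_def2 in Hn; lra. }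
assert (Ha0 : eventually (fun n => 0 < IZR (a n))).
{ generalize (filter_and _ _ Hb' Hpos); apply filter_imp; intros n [P Q].
  pose proof (exp_pos (c (INR n))).
  replace (IZR (a n)) with
    (IZR (a n) / (b (INR n) * exp (c (INR n))) * (b (INR n) * exp (c (INR n))))
    by (field; lra).
  apply Rmult_lt_0_compat; [exact Q|now apply Rmult_lt_0_compat]. }
repeat split; auto.
- revert Ha0; apply filter_imp; intros n; apply lt_IZR.
- apply is_lim_seq_ext_loc with
    (fun n => ln (IZR (a n) / (b (INR n) * exp (c (INR n))))).
  + generalize (filter_and _ _ Hb' Ha0); apply filter_imp; intros n [P Q].
    pose proof (exp_pos (c (INR n))).
    rewrite ln_div, ln_mult, ln_exp by first [assumption | now apply Rmult_lt_0_compat].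
    ring.
  + rewrite <- ln_1; apply is_lim_seq_continuous; [|exact Ha].
    apply continuity_pt_filterlim, continuous_ln; lra.
Qed.

(* A negative leading behaviour would force [ln (a n)] to tend to [-oo], which is
   impossible for positive integers. *)
Lemma integer_log_diverges (a : nat -> Z) h lam f :
  lam <> 0 -> slow lam (diffs (S h) f) -> eventually (fun n => (0 < a n)%Z) ->
  is_lim_seq (fun n => ln (IZR (a n)) - f n) 0 ->
  is_lim_seq (fun n => ln (IZR (a n))) p_infty.
Proof.
intros Hlam Hf Ha Hd.
destruct (Rlt_or_le 0 lam) as [L|L].
- apply is_lim_seq_ext with (fun n => (ln (IZR (a n)) - f n) + f n); [intros; ring|].
  now eapply is_lim_seq_plus;
    [exact Hd|apply (slow_diffs_pos_growth h lam); [exact L|exact Hf]|].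
- exfalso.
  assert (G : is_lim_seq (fun n => -1 * f n) p_infty).
  { apply (slow_diffs_pos_growth h (-1 * lam)); [lra|].
    apply slow_scal with (x := -1) in Hf; revert Hf; apply slow_ext; intros n.
    symmetry; apply (diffs_scal (S h)). }
  apply is_lim_seq_spec in G; apply is_lim_seq_spec in Hd.
  destruct (filter_and _ _ Ha (filter_and _ _ (G 1) (Hd (mkposreal 1 Rlt_0_1)))) as [N HN].
  destruct (HN N (le_n _)) as [A1 [A2 A3]]; simpl in A3; apply Rabs_def2 in A3.
  assert (0 <= ln (IZR (a N))) by (rewrite <- ln_1; apply ln_le; [lra|apply IZR_le; lia]).
  lra.
Qed.

Theorem theorem1p1 (a : nat -> Z) (ha : good a) : benford a.
Proof.
intros k d Hk Hd.
exists (log_base (IZR k) (IZR (d + 1)) - log_base (IZR k) (IZR d)).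
split; [|exists 0%Z; ring].
destruct (good_log a ha) as (h & lam & f & Hlam & Hf & Ha & Hlim).
assert (Hinf := integer_log_diverges a h lam f Hlam Hf Ha Hlim).
apply is_lim_seq_spec in Hinf.
(* Beyond [N] one has [a n >= d + 1], as the logarithmic description of first digits requires. *)
destruct (filter_and _ _ Ha (Hinf (ln (IZR (d + 1))))) as [N HN].
assert (Hbig : forall n, (N <= n)%nat -> (d + 1 <= a n)%Z).
{ intros n Hn; destruct (HN n Hn) as [A1 A2].
  apply Z.lt_le_incl, lt_IZR, ln_lt_inv; auto; apply (IZR_lt 0); lia. }
assert (Hk' : 1 < IZR k) by (apply (IZR_lt 1); lia).
assert (Hl : 0 < ln (IZR k)) by (rewrite <- ln_1; apply ln_increasing; lra).
apply is_lim_B_of_Mean, (Mean_of_shift N).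
apply weyl_equidistributed with (fun n => / ln (IZR k) * ln (IZR (a (n + S N)%nat))).
- apply (weyl_of_slow_diffs h lam f (fun n => ln (IZR (a n)))); auto.
  now apply Rgt_not_eq, Rinv_0_lt_compat.
- assert (Hd' : 0 < IZR d) by (apply (IZR_lt 0); lia).
  rewrite plus_IZR; unfold log_base; split.
  + apply Rmult_le_compat_r; [now apply Rlt_le, Rinv_0_lt_compat|apply ln_le; lra].
  (* The arc has length at most 1 because [d + 1 <= d * k]. *)
  + replace (ln (IZR d) / ln (IZR k) + 1) with (ln (IZR d * IZR k) / ln (IZR k))
      by (rewrite ln_mult by lra; field; lra).
    apply Rmult_le_compat_r; [now apply Rlt_le, Rinv_0_lt_compat|apply ln_le; [lra|]].
    assert (2 <= IZR k) by now apply IZR_le.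
    assert (1 <= IZR d) by now apply IZR_le.
    nra.
- intros n; rewrite Nat.add_succ_r; set (m := a (S (n + N))).
  assert (Hm : (d + 1 <= m)%Z) by (apply Hbig; lia).
  replace (/ ln (IZR k) * ln (IZR m)) with (log_base (IZR k) (IZR m))
    by apply Rmult_comm.
  rewrite <- first_digits_iff_arc, <- first_digitsP by assumption.
  replace (0 <? m)%Z with true by (symmetry; apply Z.ltb_lt; lia); simpl.
  destruct (first_digitsb k d m); auto.
Qed.
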